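(* There is a numerical constant $C>0$ such that the following holds. Let $\Omega$ be (the vertex set of) a finite Schreier or Cayley graph, associated with a finite group $G$ acting transitively on $\Omega$ and a generating set $S$ of $G$ that is symmetric and stable by conjugacy, and let $\lambda$ and $\rho$ be its spectral gap and logarithmic Sobolev constants. Let $f:\Omega\to\mathbb{R}$. Then, for every $\eta\in[0,1)$, $$ \mathcal{S}_\eta(f)\;\le\;\frac{C}{\lambda}\left(\frac{1}{2|S|}\sum_{s\in S}I_s(f)^2\right)^{\alpha(\eta)}\|f\|_2^{2-2\alpha(\eta)}, $$ where $$ \alpha(\eta)=\frac{1-(1-\eta)^{\rho/(2\lambda)}}{2}\;\ge\;\frac{\rho}{4\lambda}\,\eta . $$
   Context: Let $G$ be a finite group with a generating set $S$ that is symmetric ($S^{-1}=S$) and stable by conjugacy, acting transitively on a finite set $\Omega$; $x^g$ denotes the action of $g\in G$ on $x\in\Omega$ (a right action, $x^{gh}=(x^g)^h$). The Schreier graph has vertex set $\Omega$ and edges $(x,x^s)$, $x\in\Omega$, $s\in S$. The Cayley graph is the special case $\Omega=G$ with edges $(g,gs)$. Let $\mu$ be the uniform probability measure on $\Omega$; norms $\|\cdot\|_p$ are those of $L^p(\mu)$. For $s\in S$, $D_sf(x)=f(x^s)-f(x)$, and the influence of $s$ on $f$ is $I_s(f)=\|D_sf\|_{1}$. Let $Kf(x)=\frac1{|S|}\sum_{s\in S}f(x^s)$, $L=K-\mathrm{Id}$, $P_t=e^{tL}$ ($t\ge0$), with Dirichlet form $\mathcal{E}(f,f)=\int_\Omega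 f(-Lf)\,d\mu=\frac{1}{2|S|}\sum_{s\in S}\|D_sf\|_2^2$. Write $\mathrm{Var}_\mu(f)=\int f^2d\mu-(\int f\,d\mu)^2$ and, for $g\ge0$, $\mathrm{Ent}_\mu(g)=\int g\log g\,d\mu-\int g\,d\mu\,\log\int g\,d\mu$. The spectral gap constant $\lambda$ is the largest constant such that $\lambda\,\mathrm{Var}_\mu(f)\le\mathcal{E}(f,f)$ for all $f:\Omega\to\mathbb{R}$; the logarithmic Sobolev constant $\rho$ is the largest constant such that $\rho\,\mathrm{Ent}_\mu(f^2)\le2\,\mathcal{E}(f,f)$ for all $f:\Omega\to\mathbb{R}$. Noise stability: $\mathcal{S}_\eta(f)=\mathrm{Var}_\mu(P_tf)$ where $t\ge0$ is defined by $e^{-2\lambda t}=1-\eta$. *)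

(* Defs.v *)
From mathcomp Require Import all_boot all_order all_algebra all_fingroup.
From mathcomp Require Import all_classical all_reals all_analysis.

Set Implicit Arguments.
Unset Strict Implicit.
Unset Printing Implicit Defensive.

Import Order.TTheory GRing.Theory Num.Theory.
Import numFieldNormedType.Exports.
Local Open Scope classical_set_scope.
Local Open Scope ring_scope.

Definition is_largest {R : realType} (A : set R) (a : R) : Prop :=
  A a /\ ubound A a.

Section UniformMeasure.
Context {R : realType} {Omega : finType}.
Implicit Types f g : Omega -> R.

Definition mean f : R := (#|Omega|%:R)^-1 * \sum_(x : Omega) f x.

Definition Lpnorm (p : R) f : R := (mean (fun x => `|f x| `^ p)) `^ p^-1.

Definition Var f : R := mean (fun x => f x ^+ 2) - mean f ^+ 2.

(* [ln 0 = 0], so that the usual convention [0 log 0 = 0] holds. *)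
Definition Ent g : R := mean (fun x => g x * ln (g x)) - mean g * ln (mean g).

End UniformMeasure.

Section SchreierGraph.
Context {R : realType} {gT : finGroupType} {Omega : finType}.
(* MathComp actions are right actions: [to x (g * h) = to (to x g) h]. *)
Variables (to : {action gT &-> Omega}) (S : {set gT}).
Implicit Types f : Omega -> R.

Definition Dop (s : gT) f : Omega -> R := fun x => f (to x s) - f x.

Definition influence (s : gT) f : R := Lpnorm 1 (Dop s f).

Definition Kop f : Omega -> R :=
  fun x => (#|S|%:R)^-1 * \sum_(s in S) f (to x s).

Definition Lop f : Omega -> R := fun x => Kop f x - f x.

(* The exponential series of [t L], applied to [f] and summed pointwise;
   compare with [expR t = limn (series (exp_coeff t))]. *)
Definition heat (t : R) f : Omega -> R :=
  fun x => limn (series (fun k => t ^+ k / k`!%:R * iter k Lop f x)).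

Definition dirichlet f : R := mean (fun x => f x * - Lop f x).

(* On a one-point space every constant is admissible, and there is no largest
   one, neither here nor for the logarithmic Sobolev inequality. *)
Definition is_spectral_gap (lambda : R) : Prop :=
  is_largest [set c | forall f, c * Var f <= dirichlet f] lambda.

Definition is_log_sobolev (rho : R) : Prop :=
  is_largest
    [set c | forall f, c * Ent (fun x => f x ^+ 2) <= 2 * dirichlet f] rho.

(* For [0 < lambda] and [0 <= eta < 1] the set below is a singleton; the default
   value [0] is only used outside of this range. *)
Definition noise_time (lambda eta : R) : R :=
  xget 0 [set t : R | 0 <= t /\ expR (- (2 * lambda * t)) = 1 - eta].

Definition noise_stability (lambda eta : R) f : R :=
  Var (heat (noise_time lambda eta) f).

End SchreierGraph.

Definition alpha {R : realType} (lambda rho eta : R) : R :=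
  (1 - (1 - eta) `^ (rho / (2 * lambda))) / 2.

(* Main.v *)
(* Write [f_t = P_t f] and [N t = dirichlet f_t]; then [lambda Var f_t <= N t].
   As [S] is stable by conjugacy, [D_s] commutes with [L], and each [D_s f_t] is
   again a solution of the heat equation.  Hence
   [N' t = - 1/|S| \sum_s dirichlet (D_s f_t)], which the logarithmic Sobolev
   inequality bounds by the entropies of the [(D_s f_t)^2]; the entropy of [g^2]
   is in turn bounded below by [|g|_2^2 ln (|g|_2^2 / |g|_1^2)], and
   [|D_s f_t|_1 <= I_s f].  Summing over [s] gives
   [(ln (N / A))' <= - rho ln (N / A)] with [A = 1/(2|S|) \sum_s (I_s f)^2],
   i.e. [N t <= A^(1-u) (N 0)^u] with [u = exp(- rho t)].  No hypercontractivity is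
   involved, and the exponent [1 - u] is twice [alpha]; since
   [A <= N 0 <= 2 |f|_2^2], the constant [C = 2] works. *)
Require Import Defs.
From mathcomp Require Import all_boot all_order all_algebra all_fingroup.
From mathcomp Require Import all_classical all_reals all_analysis.
From mathcomp Require Import ring lra.

Set Implicit Arguments.
Unset Strict Implicit.
Unset Printing Implicit Defensive.

Import Order.TTheory GRing.Theory Num.Theory.
Import numFieldNormedType.Exports.
Local Open Scope ring_scope.

(** * Real analysis: monotonicity, Bernoulli's inequality, a smooth absolute value *)

Section Calculus.
Context {R : realType}.

Lemma le_of_derive_le0 (F dF : R -> R) (a b : R) : a <= b ->
  (forall t, a <= t <= b -> is_derive t 1 F (dF t)) ->
  (forall t, a <= t <= b -> dF t <= 0) -> F b <= F a.
Proof.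
move=> ab dFE dF0.
have itvW t : t \in `]a, b[ -> a <= t <= b.
  by rewrite in_itv/= => /andP[/ltW -> /ltW ->].
apply: (@ler0_derive1_le_cc R F a b); rewrite ?in_itv/= ?ab ?lexx//.
- by move=> t /itvW/dFE[].
- by move=> t /itvW tab; rewrite derive1E; have [_ ->] := dFE t tab; exact: dF0.
- apply: derivable_within_continuous => t; rewrite in_itv/= => tab.
  by have [] := dFE t tab.
Qed.

Lemma is_derive_sum_cond (I : finType) (P : pred I) (F : I -> R -> R)
    (dF : I -> R) (t : R) :
  (forall i, is_derive t 1 (F i) (dF i)) ->
  is_derive t 1 (fun u => \sum_(i | P i) F i u) (\sum_(i | P i) dF i).
Proof.
move=> FE; rewrite (_ : (fun u => _) = \sum_(i | P i) F i); last first.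
  by apply/funext => u; rewrite fct_sumE.
elim/big_ind2 : _ => // [|f df g dg fE gE]; first exact: is_derive_cst.
exact: is_deriveD.
Qed.

(** Put [x = expR y] and factor out [expR (r * y)]: the bound [1 + z <= expR z] at [(1 - r) * y] and
    [- (r * y)], weighted by [r] and [1 - r], has linear terms that cancel. *)
Lemma bernoulli_powR (x r : R) : 0 < x -> 0 <= r <= 1 ->
  x `^ r <= r * x + (1 - r).
Proof.
move=> x0 /andP[r0 r1]; rewrite /powR gt_eqF//.
set y := ln x; have -> : x = expR y by rewrite lnK.
have e1 := expR_ge1Dx ((1 - r) * y); have e2 := expR_ge1Dx (- (r * y)).
have -> : r * expR y + (1 - r) =
    expR (r * y) * (r * expR ((1 - r) * y) + (1 - r) * expR (- (r * y))).
  rewrite mulrDr [X in _ = X + _]mulrCA [X in _ = _ + X]mulrCA -!expRD subrr.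
  by rewrite expR0 mulr1; congr (_ * expR _ + _); ring.
rewrite ler_peMr ?expR_ge0//.
have r1' : 0 <= 1 - r by rewrite subr_ge0.
by apply: le_trans (lerD (ler_wpM2l r0 e1) (ler_wpM2l r1' e2)); lra.
Qed.

(** After multiplication by the first root this is Cauchy-Schwarz for the vectors [(a, sqrt e)] and
    [(b, sqrt e)]. It serves as the convexity of a smooth substitute for the absolute value. *)
Lemma convex_sqrt_tangent (e a b : R) : 0 < e ->
  a / Num.sqrt (a ^+ 2 + e) * (b - a) <=
  Num.sqrt (b ^+ 2 + e) - Num.sqrt (a ^+ 2 + e).
Proof.
move=> e0; have sqe (c : R) : 0 < c ^+ 2 + e by rewrite ltr_wpDl// sqr_ge0.
set p := Num.sqrt (a ^+ 2 + e); set q := Num.sqrt (b ^+ 2 + e).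
have [p0 q0] : 0 < p /\ 0 < q by rewrite !sqrtr_gt0.
have [p2 q2] : p ^+ 2 = a ^+ 2 + e /\ q ^+ 2 = b ^+ 2 + e.
  by rewrite !sqr_sqrtr// ltW.
rewrite mulrAC ler_pdivrMr//.
suff abpq : a * b + e <= p * q.
  by rewrite mulrBl -[p * p]expr2 p2; lra.
have [|abe] := leP (a * b + e) 0.
  by move=> /le_trans; apply; rewrite mulr_ge0// ltW.
rewrite -ler_sqr ?nnegrE; [|exact: ltW|exact/ltW/mulr_gt0].
rewrite exprMn p2 q2 -subr_ge0.
rewrite (_ : _ - _ = e * (a - b) ^+ 2); last by ring.
by rewrite mulr_ge0 ?sqr_ge0// ltW.
Qed.

Lemma is_derive_sqrt_shift (e a : R) : 0 < e ->
  is_derive a 1 (fun y => Num.sqrt (y ^+ 2 + e)) (a / Num.sqrt (a ^+ 2 + e)).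
Proof.
move=> e0; have ae : 0 < a ^+ 2 + e by rewrite ltr_wpDl// sqr_ge0.
have d1 := is_derive1_sqrt ae.
have d2 : is_derive a 1 (fun y : R => y ^+ 2 + e) (2 * a).
  rewrite (_ : (fun y => _) = (@id R) ^+ 2 + cst e)//.
  apply: is_derive_eq.
  by rewrite addr0 /= expr1 /GRing.scale/= mulr1.
apply: is_derive_eq (is_derive1_comp (g := fun y => y ^+ 2 + e) d1 d2) _.
by rewrite invfM mulrAC mulrA mulVf ?pnatr_eq0// mul1r mulrC.
Qed.

End Calculus.

(** * Means, variance and entropy for the uniform measure *)

Section Mean.
Context {R : realType} {Omega : finType}.
Implicit Types f g : Omega -> R.

Lemma eq_mean f g : f =1 g -> mean f = mean g.
Proof. by move=> fg; congr (_ * _); apply: eq_bigr. Qed.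

Lemma meanD f g : mean (fun x => f x + g x) = mean f + mean g.
Proof. by rewrite /mean big_split mulrDr. Qed.

Lemma meanZ c f : mean (fun x => c * f x) = c * mean f.
Proof. by rewrite /mean -mulr_sumr mulrCA. Qed.

Lemma meanB f g : mean (fun x => f x - g x) = mean f - mean g.
Proof. by rewrite /mean sumrB mulrBr. Qed.

Lemma mean_sum (I : finType) (P : pred I) (F : I -> Omega -> R) :
  mean (fun x => \sum_(i | P i) F i x) = \sum_(i | P i) mean (F i).
Proof. by rewrite /mean exchange_big mulr_sumr. Qed.

Lemma mean_ge0 f : (forall x, 0 <= f x) -> 0 <= mean f.
Proof. by move=> f0; rewrite mulr_ge0 ?invr_ge0 ?sumr_ge0. Qed.

Lemma ler_mean f g : (forall x, f x <= g x) -> mean f <= mean g.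
Proof.
by move=> fg; rewrite ler_wpM2l ?invr_ge0// ler_sum.
Qed.

Lemma mean_cst c : (0 < #|Omega|)%N -> mean (fun _ : Omega => c) = c :> R.
Proof.
move=> n0; rewrite /mean sumr_const -[c *+ _]mulr_natl mulKf//.
by rewrite pnatr_eq0 -lt0n.
Qed.

Lemma mean_eq0 f : (0 < #|Omega|)%N -> (forall x, 0 <= f x) -> mean f = 0 ->
  forall x, f x = 0.
Proof.
move=> n0 f0 /eqP; rewrite mulf_eq0 invr_eq0 pnatr_eq0 -leqn0 leqNgt n0/=.
by rewrite psumr_eq0// => /allP fx x; apply/eqP/fx/mem_index_enum.
Qed.

Lemma Lpnorm1E f : Lpnorm 1 f = mean (fun x => `|f x|).
Proof.
rewrite /Lpnorm invr1 powRr1; last by apply: mean_ge0 => x; exact: powR_ge0.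
by apply: eq_mean => x; rewrite powRr1.
Qed.

Lemma Lpnorm2E f : Lpnorm 2 f = mean (fun x => f x ^+ 2) `^ 2^-1.
Proof.
congr (_ `^ _); apply: eq_mean => x.
by rewrite (powR_mulrn 2)// real_normK// num_real.
Qed.

Lemma Var_shift c f : (0 < #|Omega|)%N -> Var (fun x => f x + c) = Var f.
Proof.
move=> n0; rewrite /Var meanD mean_cst//.
rewrite (eq_mean (g := fun x => (f x ^+ 2 + 2 * c * f x) + c ^+ 2)); last first.
  by move=> x; ring.
by rewrite !meanD meanZ mean_cst//; ring.
Qed.

Lemma Var_le c f : (0 < #|Omega|)%N ->
  Var f <= mean (fun x => (f x - c) ^+ 2).
Proof.
by move=> n0; rewrite -(Var_shift (- c))// lerBlDr lerDl sqr_ge0.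
Qed.

Lemma Var_ge0 f : (0 < #|Omega|)%N -> 0 <= Var f.
Proof.
move=> n0; rewrite -(Var_shift (- mean f))// /Var [X in _ - X ^+ 2](meanD f).
rewrite mean_cst// subrr expr0n subr0.
by apply: mean_ge0 => x; exact: sqr_ge0.
Qed.

Lemma sqr_mean_norm_le f : (0 < #|Omega|)%N ->
  mean (fun x => `|f x|) ^+ 2 <= mean (fun x => f x ^+ 2).
Proof.
move=> n0; have := Var_ge0 (fun x => `|f x|) n0; rewrite subr_ge0.
rewrite (eq_mean (f := fun x => `|f x| ^+ 2) (g := fun x => f x ^+ 2))// => x.
by rewrite real_normK ?num_real.
Qed.

(* With [N = mean g^2] and [m = mean |g|], use [ln z >= 1 - 1 / z] pointwise at
   [z = |g| m / N], integrate it against [2 g^2], and use it again at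
   [z = N / (r m^2)].  The best choice [r = N / m^2] gives
   [Ent g^2 >= N ln (N / m^2)]; a free [r] allows summation over several [g]. *)
Lemma Ent_sqr_ge r g : (0 < #|Omega|)%N -> 0 < r ->
  mean (fun x => g x ^+ 2) * (1 + ln r) - r * mean (fun x => `|g x|) ^+ 2
    <= Ent (fun x => g x ^+ 2).
Proof.
move=> n0 r0; rewrite /Ent.
set N := mean (fun x => g x ^+ 2); set m := mean (fun x => `|g x|).
have : 0 <= N by apply: mean_ge0 => x; exact: sqr_ge0.
rewrite le_eqVlt => /predU1P[N0|N0].
  have g0 x : g x = 0.
    have := mean_eq0 n0 (fun x => sqr_ge0 (g x)) (esym N0) x.
    by move/eqP; rewrite sqrf_eq0 => /eqP.
  have -> : m = 0.
    by rewrite /m (eq_mean (g := fun=> 0)) ?mean_cst// => x; rewrite g0 normr0.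
  rewrite -N0 !mul0r (eq_mean (g := fun=> 0)) ?mean_cst//; first by lra.
  by move=> x; rewrite g0 expr0n mul0r.
have m0 : 0 < m.
  rewrite lt_neqAle mean_ge0// andbT; apply/eqP => m0.
  have g0 := mean_eq0 n0 (fun x => normr_ge0 (g x)) (esym m0).
  move: N0; rewrite /N (eq_mean (g := fun=> 0)) ?mean_cst ?ltxx// => x.
  by move/eqP: (g0 x); rewrite normr_eq0 => /eqP ->; rewrite expr0n.
have lnB (x : R) : 0 < x -> 1 - x^-1 <= ln x.
  move=> x0; have x10 : -1 < x^-1 - 1 by rewrite ltrBrDl subrr invr_gt0.
  by have := le_ln1Dx x10; rewrite addrC subrK lnV ?posrE//; lra.
have key x : g x ^+ 2 * (2 * ln (N / m) + 2) - 2 * (N / m) * `|g x| <=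
    g x ^+ 2 * ln (g x ^+ 2).
  have [->|gx0] := eqVneq (g x) 0; first by rewrite normr0 expr0n/=; lra.
  have ngx : 0 < `|g x| by rewrite normr_gt0.
  have Nm : 0 < N / m by rewrite divr_gt0.
  rewrite -(@real_normK _ (g x)) ?num_real// lnXn//.
  have := ler_wpM2l (sqr_ge0 `|g x|) (lnB _ (divr_gt0 ngx Nm)).
  rewrite invf_div (@ln_div _ `|g x|) ?posrE// [ln _ *+ 2]mulr2n.
  have -> : `|g x| ^+ 2 * (1 - N / m / `|g x|) = `|g x| ^+ 2 - N / m * `|g x|.
    by field; rewrite !gt_eqF.
  lra.
have h1 := ler_mean key.
rewrite meanB meanZ in h1.
rewrite (eq_mean (g := fun x => (2 * ln (N / m) + 2) * g x ^+ 2)) in h1;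
  last first.
  by move=> x; rewrite mulrC.
rewrite meanZ -/N -/m mulrA divfK ?gt_eqF// in h1.
rewrite ln_div ?posrE// in h1.
have rm : 0 < r * m ^+ 2 by rewrite mulr_gt0// exprn_gt0.
have := ler_wpM2l (ltW N0) (lnB _ (divr_gt0 N0 rm)).
rewrite invf_div (@ln_div _ N) ?posrE// (@lnM _ r) ?posrE ?exprn_gt0// lnXn//.
have -> : N * (1 - r * m ^+ 2 / N) = N - r * m ^+ 2 by field; rewrite gt_eqF.
by rewrite [ln _ *+ 2]mulr2n; lra.
Qed.

(** The choice [r = 1] in [Ent_sqr_ge] leaves the mean square minus the squared mean of [|g|]. This
    is how the two functional constants get compared. *)
Lemma Var_le_Ent_sqr g : (0 < #|Omega|)%N -> (forall x, 0 <= g x) ->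
  Var g <= Ent (fun x => g x ^+ 2).
Proof.
move=> n0 g0; apply: le_trans (Ent_sqr_ge g n0 ltr01).
rewrite ln1 addr0 mulr1 mul1r (eq_mean (f := fun x => `|g x|) (g := g))//.
by move=> x; rewrite ger0_norm.
Qed.

Lemma is_derive_mean (G : R -> Omega -> R) (dG : Omega -> R) (t : R) :
  (forall x, is_derive t 1 (G^~ x) (dG x)) ->
  is_derive t 1 (fun u => mean (G u)) (mean dG).
Proof.
move=> GE; exact: (is_deriveZ _ (is_derive_sum_cond xpredT GE)).
Qed.

End Mean.

(** * Dirichlet form, commutation with differences, and decay of convex functionals *)

Section Schreier.
Context {R : realType} {gT : finGroupType} {Omega : finType}.
Variables (to : {action gT &-> Omega}) (S : {set gT}).
Hypothesis S_gt0 : (0 < #|S|)%N.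
Hypothesis S_conj : forall s g : gT, s \in S -> (s ^ g)%g \in S.
Implicit Types f g : Omega -> R.

Let S_neq0 : #|S|%:R != 0 :> R.
Proof. by rewrite pnatr_eq0 -lt0n. Qed.

Lemma mean_act a f : mean (fun x => f (to x a)) = mean f.
Proof.
by rewrite /mean [in RHS](reindex_inj (act_inj to a)).
Qed.

Lemma LopE f x : Lop to S f x = #|S|%:R^-1 * \sum_(s in S) Dop to s f x.
Proof.
rewrite /Lop /Kop /Dop sumrB mulrBr sumr_const -[f x *+ _]mulr_natl.
by rewrite mulKf.
Qed.

(** Integration by parts holds for each [s] separately: [x |-> to x s] preserves the mean, so the
    two square terms of the expanded [(D_s f)^2] agree. *)
Lemma dirichletE f : dirichlet to S f =
  (2 * #|S|%:R)^-1 * \sum_(s in S) mean (fun x => Dop to s f x ^+ 2).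
Proof.
have DE s : mean (fun x => Dop to s f x ^+ 2) =
    2 * mean (fun x => - (f x * Dop to s f x)).
  have -> : mean (fun x => Dop to s f x ^+ 2) =
      mean (fun x => f x ^+ 2) + mean (fun x => f (to x s) ^+ 2)
      - 2 * mean (fun x => f x * f (to x s)).
    by rewrite -meanZ -meanD -meanB; apply: eq_mean => x; rewrite /Dop; ring.
  rewrite (mean_act s (fun x => f x ^+ 2)) -!meanZ -meanD -meanB.
  by apply: eq_mean => x; rewrite /Dop; ring.
rewrite (eq_bigr _ (fun s _ => DE s)) -mulr_sumr invfM mulrACA mulVf ?pnatr_eq0//.
rewrite mul1r -mean_sum -meanZ; apply: eq_mean => x.
by rewrite LopE mulrN mulrCA -mulrN mulr_sumr sumrN.
Qed.

Lemma dirichlet_ge0 f : 0 <= dirichlet to S f.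
Proof.
rewrite dirichletE mulr_ge0 ?invr_ge0 ?mulr_ge0// sumr_ge0// => s _.
by apply: mean_ge0 => x; exact: sqr_ge0.
Qed.

Lemma dirichlet_shift c f : dirichlet to S (fun x => f x + c) = dirichlet to S f.
Proof.
rewrite !dirichletE; congr (_ * _); apply: eq_bigr => s _; apply: eq_mean => x.
by rewrite /Dop opprD addrACA subrr addr0.
Qed.

Lemma dirichlet_le f : dirichlet to S f <= 2 * mean (fun x => f x ^+ 2).
Proof.
rewrite dirichletE ler_pdivrMl ?mulr_gt0 ?ltr0n//.
have -> : 2 * #|S|%:R * (2 * mean (fun x => f x ^+ 2)) =
    \sum_(s in S) (2 * mean (fun x => f x ^+ 2) + 2 * mean (fun x => f x ^+ 2)).
  by rewrite sumr_const -[_ *+ #|S|]mulr_natl; ring.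
apply: ler_sum => s _; rewrite -{1}(mean_act s (fun x => f x ^+ 2)) -!meanZ -meanD.
apply: ler_mean => x; rewrite /Dop -subr_ge0.
rewrite (_ : _ - _ = (f (to x s) + f x) ^+ 2) ?sqr_ge0//; ring.
Qed.

(** Stability by conjugacy enters here: [a |-> a ^ s] permutes [S], and [s * a ^ s = a * s]. *)
Lemma Dop_Lop s f x : Dop to s (Lop to S f) x = Lop to S (Dop to s f) x.
Proof.
rewrite {1}/Dop !LopE -mulrBr; congr (_ * _); rewrite /Dop !sumrB.
suff -> : \sum_(a in S) f (to (to x s) a) = \sum_(a in S) f (to (to x a) s).
  ring.
rewrite (reindex_inj (conjg_inj s)); apply: eq_big => [a|a _].
  apply/idP/idP => [aS|]; last exact: S_conj.
  by rewrite -[a](conjgK s); exact: S_conj.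
by rewrite -!actM -conjgC.
Qed.

(** The tangent inequality bounds the time derivative by an average over [s] of the means of
    [phi (G u (to x s)) - phi (G u x)], each of which vanishes by invariance. *)
Lemma convex_decay (phi dphi : R -> R) (G : R -> Omega -> R) (t : R) :
  (forall y : R, is_derive y 1 phi (dphi y)) ->
  (forall a b, dphi a * (b - a) <= phi b - phi a) ->
  (forall (u : R) x, is_derive u 1 (G^~ x) (Lop to S (G u) x)) ->
  0 <= t -> mean (fun x => phi (G t x)) <= mean (fun x => phi (G 0 x)).
Proof.
move=> phiE phic GE t0.
apply: (@le_of_derive_le0 _ (fun u => mean (fun x => phi (G u x)))
    (fun u => mean (fun x => dphi (G u x) * Lop to S (G u) x))) => // u _.
  apply: is_derive_mean => x; exact: is_derive1_comp.
rewrite (eq_mean (g := fun x => #|S|%:R^-1 *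
    \sum_(s in S) dphi (G u x) * Dop to s (G u) x)); last first.
  by move=> x; rewrite LopE mulrCA mulr_sumr.
rewrite meanZ mean_sum mulr_ge0_le0 ?invr_ge0// sumr_le0// => s _.
apply: le_trans (ler_mean (fun x => phic _ _)) _.
by rewrite meanB (mean_act s (fun x => phi (G u x))) subrr.
Qed.

(** The absolute value is not differentiable at 0, so [convex_decay] is applied to
    [sqrt (y ^+ 2 + e ^+ 2)], which lies between [|y|] and [|y| + e], with [e] arbitrarily small. *)
Lemma L1_decay (G : R -> Omega -> R) (t : R) : (0 < #|Omega|)%N ->
  (forall (u : R) x, is_derive u 1 (G^~ x) (Lop to S (G u) x)) ->
  0 <= t -> mean (fun x => `|G t x|) <= mean (fun x => `|G 0 x|).
Proof.
move=> n0 GE t0; apply/ler_addgt0Pr => e e0.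
have e2 : 0 < e ^+ 2 by rewrite exprn_gt0.
have := convex_decay (fun y => is_derive_sqrt_shift y e2)
  (fun a b => convex_sqrt_tangent a b e2) GE t0.
move=> h; apply: le_trans (le_trans h _).
  apply: ler_mean => x; rewrite -sqrtr_sqr ler_wsqrtr// lerDl ltW//.
rewrite -[X in _ + X](mean_cst e n0) -meanD; apply: ler_mean => x.
rewrite -[leRHS]ger0_norm ?addr_ge0 ?(ltW e0)// -sqrtr_sqr ler_wsqrtr//.
rewrite sqrrD real_normK ?num_real// lerD2r lerDl mulrn_wge0//.
by rewrite mulr_ge0// ltW.
Qed.

End Schreier.

(** * Series of exponential type and their termwise derivative *)

Section ExponentialSeries.
Local Open Scope classical_set_scope.
Local Open Scope ring_scope.
Context {R : realType}.

Lemma is_cvg_exp_pseries (a : nat -> R) (c M t : R) : 0 <= c -> 0 <= M ->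
  (forall k, `|a k| <= c * M ^+ k) ->
  cvgn (pseries (fun k => a k / k`!%:R) t).
Proof.
move=> c0 M0 aM; apply: normed_cvg.
apply: (@series_le_cvg _ _ (fun k => c * exp_coeff (M * `|t|) k)) => [k|k|k|] //=.
- by rewrite mulr_ge0// mulr_ge0 ?invr_ge0// exprn_ge0// mulr_ge0.
- rewrite /exp_coeff/= !normrM normrX [`|k`!%:R^-1|]ger0_norm ?invr_ge0//.
  rewrite exprMn mulrAC mulrA mulrA ler_wpM2r ?invr_ge0//.
  by rewrite ler_wpM2r ?exprn_ge0.
  exact: (@is_cvg_seriesZ R (exp_coeff (M * `|t|)) c (is_cvg_series_exp_coeff _)).
Qed.

(** With coefficients [a k / k!], differentiation is a shift of [a], and shifted sequences keep a
    geometric bound with the same [M]. *)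
Lemma is_derive_exp_pseries (a : nat -> R) (c M t : R) : 0 <= c -> 0 <= M ->
  (forall k, `|a k| <= c * M ^+ k) ->
  is_derive t 1 (fun u => limn (pseries (fun k => a k / k`!%:R) u))
    (limn (pseries (fun k => a k.+1 / k`!%:R) t)).
Proof.
move=> c0 M0 aM.
have diffsE (b : nat -> R) : pseries_diffs (fun k => b k / k`!%:R) =
    (fun k => b k.+1 / k`!%:R).
  apply/funext => k; rewrite /pseries_diffs factS natrM invfM mulrCA.
  by rewrite mulVKf ?pnatr_eq0.
have a1M k : `|a k.+1| <= c * M * M ^+ k by rewrite -mulrA -exprS.
have a2M k : `|a k.+2| <= c * M * M * M ^+ k by rewrite -!mulrA -!exprS.
(* Any point beyond [|t|] would do: the series and its first two formal derivatives converge
   there. *)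
rewrite -diffsE; apply: (@pseries_snd_diffs _ _ (`|t| + 1)); rewrite ?diffsE.
- exact: is_cvg_exp_pseries aM.
- by apply: is_cvg_exp_pseries a1M => //; rewrite mulr_ge0.
- by apply: is_cvg_exp_pseries a2M => //; rewrite !mulr_ge0.
- by rewrite [ltRHS]ger0_norm ?addr_ge0// ltrDl.
Qed.

Lemma cvgn_sum (I : finType) (P : pred I) (u : I -> nat -> R) (l : I -> R) :
  (forall i, u i n @[n --> \oo] --> l i) ->
  (\sum_(i | P i) u i n) @[n --> \oo] --> \sum_(i | P i) l i.
Proof.
move=> ul; rewrite (_ : (fun n => _) = \sum_(i | P i) u i); last first.
  by apply/funext => n; rewrite fct_sumE.
elim/big_ind2 : _ => // [|v a w b va wb]; first exact: cvg_cst.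
exact: cvgD.
Qed.

End ExponentialSeries.

(** * The heat semigroup solves the heat equation *)

Section Heat.
Local Open Scope classical_set_scope.
Local Open Scope ring_scope.
Context {R : realType} {gT : finGroupType} {Omega : finType}.
Variables (to : {action gT &-> Omega}) (S : {set gT}).
Hypothesis S_gt0 : (0 < #|S|)%N.
Implicit Types f : Omega -> R.

Lemma norm_Lop_le c f : (forall x, `|f x| <= c) ->
  forall x, `|Lop to S f x| <= c * 2.
Proof.
move=> fc x; rewrite LopE// normrM ger0_norm ?invr_ge0//.
rewrite ler_pdivrMl ?ltr0n// mulr_natl -sumr_const.
apply: le_trans (ler_norm_sum _ _ _) _; apply: ler_sum => s _.
by apply: le_trans (ler_normB _ _) _; rewrite mulr_natr mulr2n lerD.
Qed.

Lemma norm_iter_Lop_le f k x :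
  `|iter k (Lop to S) f x| <= (\sum_y `|f y|) * 2 ^+ k.
Proof.
elim: k x => [|k IH] x.
  by rewrite mulr1/= (bigD1 x)//= lerDl sumr_ge0.
by rewrite exprSr mulrA; exact: norm_Lop_le.
Qed.

Lemma heatE t f x : heat to S t f x =
  limn (pseries (fun k => iter k (Lop to S) f x / k`!%:R) t).
Proof.
rewrite /heat /pseries; congr (limn (series _)).
by apply/funext => k; rewrite mulrC mulrA mulrAC.
Qed.

(** The termwise derivative is the series of the iterates [k.+1]. As [Lop] is a finite combination
    of point evaluations, it passes through the pointwise limit. *)
Lemma is_derive_heat f x (t : R) :
  is_derive t 1 (fun u => heat to S u f x) (Lop to S (heat to S t f) x).
Proof.
have f0 : 0 <= \sum_y `|f y| by apply: sumr_ge0.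
have fM y k := norm_iter_Lop_le f k y.
have cvgf y : pseries (fun k => iter k (Lop to S) f y / k`!%:R) t @ \oo -->
    heat to S t f y.
  by rewrite heatE; exact: (is_cvg_exp_pseries f0 (ler0n _ _) (fM y)).
under eq_fun do rewrite heatE; apply: is_derive_eq.
  exact: (is_derive_exp_pseries _ f0 (ler0n _ _) (fM x)).
apply: cvg_lim => //; rewrite LopE//.
rewrite (_ : pseries _ _ = fun n => #|S|%:R^-1 * \sum_(s in S)
    (pseries (fun k => iter k (Lop to S) f (to x s) / k`!%:R) t n -
     pseries (fun k => iter k (Lop to S) f x / k`!%:R) t n)).
  apply: cvgMl_tmp; apply: cvgn_sum => s; exact: cvgB.
apply/funext => n; rewrite /pseries /series/= mulr_sumr.
under [RHS]eq_bigr do rewrite -sumrB mulr_sumr.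
rewrite exchange_big; apply: eq_bigr => k _ /=.
rewrite LopE// -mulr_sumr -!(mulrA #|S|%:R^-1); congr (_ * _); rewrite !mulr_suml.
by apply: eq_bigr => s _; rewrite -!mulrBl.
Qed.

Lemma heat0 f x : heat to S 0 f x = f x.
Proof.
(* The partial sums equal [f x] from [n = 1] on; the one at [n = 0] is empty. *)
rewrite /heat; apply: lim_near_cst => //; exists 1%N => // n /= n0.
rewrite -(prednK n0) /series/= big_nat_recl// big1 ?addr0.
  by rewrite expr0 fact0 divr1 mul1r.
by move=> k _; rewrite expr0n/= !mul0r.
Qed.

End Heat.

(** * Decay of the energy along a solution of the heat equation *)

Section EnergyDecay.
Context {R : realType} {gT : finGroupType} {Omega : finType}.
Variables (to : {action gT &-> Omega}) (S : {set gT}).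
Hypothesis Omega_gt0 : (0 < #|Omega|)%N.
Hypothesis S_gt0 : (0 < #|S|)%N.
Hypothesis S_conj : forall s g : gT, s \in S -> (s ^ g)%g \in S.
Variables (rho : R) (H : R -> Omega -> R).
Hypothesis rho_ge0 : 0 <= rho.
Hypothesis log_sobolev : forall g : Omega -> R,
  rho * Ent (fun x => g x ^+ 2) <= 2 * dirichlet to S g.
Hypothesis H_flow : forall (u : R) x, is_derive u 1 (H^~ x) (Lop to S (H u) x).

Local Notation w := ((2 * #|S|%:R)^-1 : R).
Local Notation A :=
  (w * \sum_(s in S) mean (fun x => `|Dop to s (H 0) x|) ^+ 2).
Let N (u : R) := dirichlet to S (H u).
Let dN (u : R) := - (2 * (w * \sum_(s in S) dirichlet to S (Dop to s (H u)))).

Let w_ge0 : 0 <= w. Proof. by rewrite invr_ge0 mulr_ge0. Qed.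

Let D_flow s (u : R) x :
  is_derive u 1 (fun v => Dop to s (H v) x) (Lop to S (Dop to s (H u)) x).
Proof. by rewrite -Dop_Lop//; exact: is_deriveB. Qed.

Let is_derive_energy (u : R) : is_derive u 1 N (dN u).
Proof.
rewrite (_ : N = fun v => w * \sum_(s in S) mean (fun x => Dop to s (H v) x ^+ 2));
  last by apply/funext => v; rewrite /N dirichletE.
have dD s : is_derive u 1 (fun v => mean (fun x => Dop to s (H v) x ^+ 2))
    (- (2 * dirichlet to S (Dop to s (H u)))).
  rewrite -mulrN /dirichlet -[- mean _]mulN1r -meanZ -meanZ.
  apply: is_derive_mean => x; have := D_flow s u x => Dsx.
  rewrite (_ : (fun v => _) = (fun v => Dop to s (H v) x) ^+ 2)//.
  by apply: is_derive_eq; rewrite /GRing.scale/= expr1; ring.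
apply: is_derive_eq; first exact: (is_deriveZ w (is_derive_sum_cond (mem S) dD)).
by rewrite /GRing.scale/= /dN sumrN mulrN -mulr_sumr mulrCA.
Qed.

Lemma energy_le (u t : R) : u <= t -> dirichlet to S (H t) <= dirichlet to S (H u).
Proof.
move=> ut; apply: (@le_of_derive_le0 _ N dN) => // v _.
by rewrite oppr_le0 mulr_ge0// mulr_ge0// sumr_ge0// => s _; exact: dirichlet_ge0.
Qed.

Let A_ge0 : 0 <= A.
Proof. by rewrite mulr_ge0// sumr_ge0// => s _; exact: sqr_ge0. Qed.

Lemma sum_sqr_L1_le : A <= dirichlet to S (H 0).
Proof.
rewrite dirichletE// ler_wpM2l// ler_sum// => s _; exact: sqr_mean_norm_le.
Qed.

(* [Ent_sqr_ge] is applied to every [Dop to s (H u)] with the same [r = N u / A]. *)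
Let dissipation (u : R) : 0 <= u -> 0 < A -> 0 < N u ->
  dN u <= - (rho * (N u * (ln (N u) - ln A))).
Proof.
move=> u0 A0 Nu0; rewrite lerN2.
have r0 : 0 < N u / A by rewrite divr_gt0.
have NE : N u = w * \sum_(s in S) mean (fun x => Dop to s (H u) x ^+ 2).
  by rewrite /N dirichletE.
set r := N u / A in r0 *; have rA : r * A = N u by rewrite /r divfK// gt_eqF.
rewrite -ln_div ?posrE// -/r.
(* As [r * A = N u], the added terms cancel; in this form the bound is a sum over [s] that can be
   compared term by term. *)
have -> : N u * ln r = N u * (1 + ln r) - r * A by rewrite rA; ring.
rewrite {1}NE /A [r * _]mulrCA -mulrA -mulrBr mulr_suml mulr_sumr -sumrB.
rewrite mulrCA [X in _ <= X]mulrCA !mulr_sumr ler_sum// => s _.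
rewrite ler_wpM2l//; apply: le_trans (log_sobolev (Dop to s (H u))).
rewrite ler_wpM2l//; apply: le_trans (Ent_sqr_ge _ Omega_gt0 r0).
rewrite lerD2l lerN2 ler_pM2l// ler_sqr ?nnegrE ?mean_ge0//.
by apply: (L1_decay (G := fun v => Dop to s (H v)) S_gt0 Omega_gt0) => // v x;
  exact: D_flow.
Qed.

(** By [energy_le], positivity at time [t] extends to all earlier times, so [ln (N u)] is
    differentiable on the whole interval and [dissipation] can be integrated. *)
Lemma ln_energy_decay (t : R) : 0 <= t -> 0 < dirichlet to S (H t) ->
  0 < A /\ ln (dirichlet to S (H t)) <=
    (1 - expR (- (rho * t))) * ln A + expR (- (rho * t)) * ln (dirichlet to S (H 0)).
Proof.
move=> t0 Nt0; have N_gt0 u : u <= t -> 0 < N u.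
  by move=> /energy_le; exact: lt_le_trans.
(* If [A] were 0, every [Dop to s (H 0)] with [s] in [S] would vanish, and so would [N 0]. *)
have A0 : 0 < A.
  rewrite lt_neqAle A_ge0 andbT; apply/eqP => /esym/eqP A0.
  have := N_gt0 0 t0; rewrite /N dirichletE// big1 ?mulr0 ?ltxx// => s sS.
  move: A0; rewrite mulf_eq0 invr_eq0 mulf_eq0 !pnatr_eq0/= -leqn0 leqNgt S_gt0/=.
  rewrite psumr_eq0 => [/allP/(_ s (mem_index_enum s))|i _]; last exact: sqr_ge0.
  rewrite sS/= sqrf_eq0 => /eqP /(mean_eq0 Omega_gt0 (fun x => normr_ge0 _)) D0.
  rewrite (eq_mean (g := fun=> 0)) ?mean_cst// => x.
  by move/eqP: (D0 x); rewrite normr_eq0 => /eqP ->; rewrite expr0n.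
(* [expR (rho * u)] is the integrating factor of the differential inequality for
   [ln (N u) - ln A]. *)
split=> //; pose F u := expR (rho * u) * (ln (N u) - ln A).
have Fle : F t <= F 0.
  apply: (@le_of_derive_le0 _ F (fun u => expR (rho * u) *
      (rho * (ln (N u) - ln A) + (N u)^-1 * dN u))) => // u /andP[u0 ut].
    have Nu := N_gt0 u ut.
    have d1 : is_derive u 1 (fun v => expR (rho * v)) (expR (rho * u) * rho).
      apply: is_derive_eq (is_derive1_comp (g := fun v => rho * v)
        (is_derive_expR _) (is_deriveZ rho (is_derive_id u 1))) _.
      by rewrite /GRing.scale/= mulr1.
    have d2 := is_deriveB (is_derive1_comp (is_derive1_ln Nu) (is_derive_energy u))
      (is_derive_cst (ln A) u 1).
    apply: is_derive_eq (is_deriveM d1 d2) _.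
    by rewrite /GRing.scale/= subr0 -[X in _ + X * _]/(ln (N u) - ln A); ring.
  rewrite mulr_ge0_le0 ?expR_ge0//.
  have Nu := N_gt0 u ut; have NV0 : 0 <= (N u)^-1 by rewrite invr_ge0 ltW.
  have := ler_wpM2l NV0 (dissipation u0 A0 Nu).
  have -> : (N u)^-1 * - (rho * (N u * (ln (N u) - ln A))) =
      - (rho * (ln (N u) - ln A)) by field; rewrite gt_eqF.
  by lra.
have e0 : expR (- (rho * t)) * expR (rho * t) = 1 by rewrite -expRD addNr expR0.
move: Fle; rewrite /F mulr0 expR0 mul1r.
rewrite -(ler_pM2l (expR_gt0 (- (rho * t)))) mulrA e0 mul1r -/(N t) -/(N 0).
by move=> h; lra.
Qed.

End EnergyDecay.

(** * Positivity and comparison of the two constants *)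

Section Constants.
Context {R : realType} {gT : finGroupType} {Omega : finType}.
Variables (to : {action gT &-> Omega}) (S : {set gT}).
Hypothesis trans : [transitive [set: gT], on [set: Omega] | to].
Hypothesis S_gen : (<<S>>)%g = [set: gT].
Implicit Types f : Omega -> R.

Let reach x y : exists g, y = to x g.
Proof.
by have [g _ ->] := atransP2 trans (finset.in_setT x) (finset.in_setT y); exists g.
Qed.

Lemma card_transitive_gt0 : (0 < #|Omega|)%N.
Proof. by have /imsetP[x _ _] := trans; apply/card_gt0P; exists x. Qed.

Lemma spectral_gap_gens_gt0 (lambda : R) :
  is_spectral_gap to S lambda -> (0 < #|S|)%N.
Proof.
move=> [_ ub]; rewrite lt0n; apply/negP => /eqP/cards0_eq S0.
have n0 := card_transitive_gt0.
(* An empty [S] generates the trivial group, so [Omega] is a single point, all variances vanish, and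
   every constant is admissible: there is no largest one. *)
have : lambda + 1 <= lambda; last by rewrite gerDl ler10.
apply: ub => f /=.
have Var0 : Var f <= 0.
  have /card_gt0P[x0 _] := n0.
  apply: le_trans (Var_le (f x0) f n0) _.
  rewrite (eq_mean (g := fun=> 0)) ?mean_cst// => x.
  have [g ->] := reach x0 x.
  have : g \in <<S>>%g by rewrite S_gen inE.
  by rewrite S0 gen0 => /set1P ->; rewrite act1 subrr expr0n.
have -> : Var f = 0 by apply/eqP; rewrite eq_le Var0 Var_ge0.
rewrite mulr0; apply: mean_ge0 => x.
by rewrite /Lop /Kop S0 big_set0 mulr0 sub0r opprK -expr2 sqr_ge0.
Qed.

Hypothesis S_gt0 : (0 < #|S|)%N.

(** A Poincaré inequality along the move [g]. It holds for generators and passes to products, hence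
    holds on the whole group. *)
Let bounded g := exists2 c, 0 <= c &
  forall f x, (f (to x g) - f x) ^+ 2 <= c * dirichlet to S f.

Let bounded_gen s : s \in S -> bounded s.
Proof.
move=> sS; exists (2 * #|S|%:R * #|Omega|%:R) => [|f x]; first by rewrite !mulr_ge0.
have S0 : #|S|%:R != 0 :> R by rewrite pnatr_eq0 -lt0n.
have O0 : #|Omega|%:R != 0 :> R by rewrite pnatr_eq0 -lt0n card_transitive_gt0.
rewrite dirichletE// [2 * _ * _]mulrC -mulrA mulVKf ?mulf_neq0//.
rewrite mulr_sumr (bigD1 s)//= /mean mulVKf// (bigD1 x)//= -addrA lerDl.
rewrite addr_ge0// sumr_ge0// => [y _|a _]; first exact: sqr_ge0.
by rewrite mulVKf// sumr_ge0// => y _; exact: sqr_ge0.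
Qed.

Let bounded_all g : bounded g.
Proof.
pose B := [set g | `[< bounded g >]]%SET.
have B_group : group_set B.
  apply/group_setP; split.
    by rewrite inE; apply/asboolP; exists 0 => // f x; rewrite act1 subrr expr0n mul0r.
  move=> a b; rewrite !inE => -[c c0 ac] [d d0 bd].
  (* The constant comes from [(p - r)^2 <= 2 (p - q)^2 + 2 (q - r)^2], where the difference of the
     two sides is [(p - 2 q + r)^2]. *)
  exists (2 * (c + d)); first by rewrite mulr_ge0 ?addr_ge0.
  move=> f x; rewrite actM; have := ac f x; have := bd f (to x a).
  set p := f (to (to x a) b); set q := f (to x a); move=> h1 h2.
  have : 0 <= (p - 2 * q + f x) ^+ 2 by exact: sqr_ge0.
  by nra.
have : g \in <<S>>%g by rewrite S_gen inE.
suff /fintype.subsetP SB : <<S>>%g \subset group B_group.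
  by move=> /SB; rewrite inE => /asboolP.
rewrite gen_subG; apply/fintype.subsetP => s sS.
by rewrite inE; apply/asboolP/bounded_gen.
Qed.

(** By maximality one positive admissible constant suffices. Every point is reached from a fixed
    [x0], so [bounded_all] controls the mean of [(f x - f x0)^2]. *)
Lemma spectral_gap_gt0 (lambda : R) : is_spectral_gap to S lambda -> 0 < lambda.
Proof.
move=> [_ ub]; have n0 := card_transitive_gt0; have /card_gt0P[x0 _] := n0.
have /boolp.choice[c cP] g : exists c, 0 <= c /\
    forall f x, (f (to x g) - f x) ^+ 2 <= c * dirichlet to S f.
  by have [c] := bounded_all g; exists c.
pose C := 1 + \sum_g c g.
have C0 : 0 < C by rewrite ltr_wpDr// sumr_ge0// => g _; exact: (cP g).1.
have cC g : c g <= C.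
  rewrite /C (bigD1 g)//= addrCA lerDl addr_ge0// sumr_ge0// => h _.
  exact: (cP h).1.
apply: lt_le_trans (ub C^-1 _); first by rewrite invr_gt0.
move=> f /=; rewrite ler_pdivrMl//; apply: le_trans (Var_le (f x0) f n0) _.
rewrite -[leRHS](mean_cst _ n0); apply: ler_mean => x.
have [g ->] := reach x0 x; apply: le_trans ((cP g).2 f x0) _.
by rewrite ler_wpM2r// dirichlet_ge0.
Qed.

Lemma log_sobolev_ge0 (rho : R) : is_log_sobolev to S rho -> 0 <= rho.
Proof.
by move=> [_ ub]; apply: ub => f /=; rewrite mul0r mulr_ge0// dirichlet_ge0.
Qed.

(** Variance and energy ignore constants, so [f] may be shifted to be nonnegative; [Var_le_Ent_sqr]
    then makes [rho / 2] admissible for the gap. This puts [rho / (2 * lambda)] in the range of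
    [bernoulli_powR]. *)
Lemma log_sobolev_le (lambda rho : R) : is_spectral_gap to S lambda ->
  is_log_sobolev to S rho -> rho <= 2 * lambda.
Proof.
move=> [_ ub] LS; have rho0 := log_sobolev_ge0 LS; have [ls _] := LS.
have n0 := card_transitive_gt0.
rewrite -ler_pdivrMl//; apply: ub => f /=.
rewrite -mulrA ler_pdivrMl//.
pose c := \sum_x `|f x|.
have fc x : 0 <= f x + c.
  rewrite /c (bigD1 x)//= addrA addr_ge0 ?sumr_ge0//.
  by rewrite -lerBlDl sub0r ler_normr lexx orbT.
rewrite -(Var_shift c)// -(dirichlet_shift to S_gt0 c).
by apply: le_trans (ls (fun x => f x + c)); rewrite ler_wpM2l// Var_le_Ent_sqr.
Qed.

End Constants.

(** * From energy decay to noise stability, compared in logarithms *)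

Theorem theorem4p2 (R : realType) :
  exists C : R, 0 < C /\
    forall (gT : finGroupType) (Omega : finType)
           (to : {action gT &-> Omega}) (S : {set gT}) (lambda rho : R),
      [transitive [set: gT], on [set: Omega] | to] ->
      (<<S>>)%g = [set: gT] ->
      (forall s : gT, s \in S -> (s^-1)%g \in S) ->
      (forall s g : gT, s \in S -> (s ^ g)%g \in S) ->
      is_spectral_gap to S lambda ->
      is_log_sobolev to S rho ->
      forall (f : Omega -> R) (eta : R), 0 <= eta -> eta < 1 ->
        noise_stability to S lambda eta f
          <= C / lambda
             * ((2 * #|S|%:R)^-1 * \sum_(s in S) influence to s f ^+ 2)
                 `^ alpha lambda rho eta
             * Lpnorm 2 f `^ (2 - 2 * alpha lambda rho eta)
        /\ alpha lambda rho eta >= rho / (4 * lambda) * eta.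
Proof.
exists 2; split=> // gT Omega to S lambda rho trans S_gen _ S_conj gap LS f eta.
move=> eta0 eta1.
have n0 := card_transitive_gt0 trans.
have S0 := spectral_gap_gens_gt0 trans S_gen gap.
have lambda0 := spectral_gap_gt0 trans S_gen S0 gap.
have rho0 := log_sobolev_ge0 S0 LS.
have rho_le := log_sobolev_le trans S0 gap LS.
have x0 : 0 < 1 - eta by rewrite subr_gt0.
have [T0 expT] : 0 <= noise_time lambda eta /\
    expR (- (2 * lambda * noise_time lambda eta)) = 1 - eta.
  apply: (@xgetPex _ 0 [set t : R | 0 <= t /\ expR (- (2 * lambda * t)) = 1 - eta]%classic).
  (* Solving for [t] shows that the set is inhabited, so [noise_time] is not its default value. *)
  exists (- (2 * lambda)^-1 * ln (1 - eta)); split.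
    rewrite mulNr oppr_ge0 mulr_ge0_le0 ?ln_le0 ?invr_ge0 ?mulr_ge0 ?(ltW lambda0)//.
    by rewrite gerBl.
  by rewrite mulrA mulrN mulfV ?gt_eqF ?mulr_gt0// mulN1r opprK lnK.
have alphaE : alpha lambda rho eta = (1 - expR (- (rho * noise_time lambda eta))) / 2.
  rewrite /alpha -expT -expRM; congr ((1 - expR _) / 2); field.
  by rewrite gt_eqF.
split; last first.
  have r01 : 0 <= rho / (2 * lambda) <= 1.
    by rewrite divr_ge0 ?mulr_ge0 ?(ltW lambda0)//= ler_pdivrMr ?mul1r// mulr_gt0.
  have := bernoulli_powR x0 r01; rewrite /alpha.
  rewrite (_ : rho / (4 * lambda) = rho / (2 * lambda) / 2); first by lra.
  by field; rewrite gt_eqF.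
rewrite alphaE /noise_stability; move: (noise_time _ _) T0 => T T0.
set u := expR _; have u01 : 0 < u <= 1.
  by rewrite expR_gt0 -expR0 ler_expR oppr_le0 mulr_ge0.
set A := _^-1 * _; set a := (1 - u) / 2.
set E := dirichlet to S (heat to S T f).
have VE : Var (heat to S T f) <= lambda^-1 * E.
  by rewrite ler_pdivlMl//; apply: gap.1.
have -> : Lpnorm 2 f `^ (2 - 2 * a) = mean (fun x => f x ^+ 2) `^ (1 - a).
  by rewrite Lpnorm2E -powRrM; congr (_ `^ _); field.
rewrite [2 / _]mulrC -!mulrA; apply: le_trans VE _; rewrite ler_pM2l ?invr_gt0//.
have : 0 <= E by exact: dirichlet_ge0.
(* Zero energy is split off, because the comparison takes the logarithm of [E]. *)
rewrite le_eqVlt => /predU1P[<-|E0]; first by rewrite !mulr_ge0 ?powR_ge0.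
have flow (v : R) x := is_derive_heat to S0 f x v.
have heat0f : heat to S 0 f = f by apply/funext => x; rewrite heat0.
have := sum_sqr_L1_le to n0 S0 (fun v => heat to S v f).
have := ln_energy_decay n0 S0 S_conj rho0 LS.1 flow T0 E0.
rewrite heat0f -/E -/u.
have -> : (2 * #|S|%:R)^-1 * \sum_(s in S) mean (fun x => `|Dop to s f x|) ^+ 2 = A.
  by congr (_ * _); apply: eq_bigr => s _; rewrite /influence Lpnorm1E.
set B := dirichlet to S f; set F := mean _ => -[A0 lnE] AB.
have B2F : B <= 2 * F by exact: dirichlet_le.
have B0 : 0 < B := lt_le_trans A0 AB.
have F0 : 0 < F by have := lt_le_trans B0 B2F; rewrite pmulr_rgt0.
rewrite -ler_ln ?posrE //; last by rewrite !mulr_gt0 ?powR_gt0.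
rewrite (@lnM _ 2) ?posrE ?mulr_gt0 ?powR_gt0//.
rewrite (@lnM _ (A `^ a)) ?posrE ?powR_gt0// !ln_powR.
have lnAB : ln A <= ln B by rewrite ler_ln.
have lnBF : ln B <= ln 2 + ln F.
  by rewrite -(@lnM _ 2) ?posrE // ler_ln ?posrE // mulr_gt0.
have ln2 : 0 <= ln 2 :> R by rewrite ln_ge0// ler1n.
move: u01 => /andP[u0 u1]; apply: le_trans lnE _.
have aE : u = 1 - 2 * a by rewrite /a; field.
have a0 : 0 <= a by rewrite divr_ge0// subr_ge0.
have a1 : 0 <= 1 - a by rewrite aE in u0; lra.
(* The decay gives [2 a ln A + (1 - 2 a) ln B]. One share [a ln A] is raised to [a ln B], then
   [(1 - a) ln B] to [(1 - a) (ln 2 + ln F)], and [(1 - a) ln 2 <= ln 2]. *)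
have h1 := ler_wpM2l a0 lnAB; have h2 := ler_wpM2l a1 lnBF.
have h3 := mulr_ge0 a0 ln2.
rewrite aE; lra.
Qed.
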